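(* Let $f$ be any honest function. Then $f\leq_{PR}\hat{G}^{\alpha^f}$, i.e. $f$ is primitive recursive in $\hat{G}^{\alpha^f}$.
   Context: A function is elementary if it can be generated from $2^x$, $\max$, $0$, successor and projections by composition and bounded primitive recursion; a relation is elementary if its characteristic function is. $\phi\leq_{PR}\psi$ means $\phi$ can be generated from the initial functions $\psi$, $2^x$, $\max$, $0$, successor, projections by composition and (unbounded) primitive recursion. Rationals are coded into $\mathbb{N}$ in a standard elementary way. A function $f:\mathbb{N}\to\mathbb{N}$ is honest if $f(x)\le f(x+1)$, $f(x)\geq 2^x$ for all $x$, and the relation $f(x)=y$ is elementary. Let $P_i$ denote the $i$-th prime ($P_0=2$). Define $g(0)=1$, $g(j+1)=P_j^{2(j+2)(g(j)+1)^3}$, $h(i)=g(f(i)+i)$, $\alpha^f_n=\sum_{i=0}^nP_i^{-h(i)}$, $\alpha^f=\lim_n\alpha^f_n$ (an irrational in $(0,1)$). For irrational $\alpha\in(0,1)$ and base $b\ge 2$ write uniquely $\alpha=\sum_{i\ge1}\mathtt{D}_ib^{-k_i}$ with $\mathtt{D}_i\in\{1,\dots,b-1\}$, $0<k_1<k_2<\cdots$; the general sum approximation from below is $\hat{G}^\alpha:\mathbb{N}\times\mathbb{N}\to\mathbb{Q}$ with $\hat{G}^\alpha(b,0)=0$, $\hat{G}^\alpha(b,n)=\mathtt{D}_nb^{-k_n}$ for $n>0$ and $b\ge 2$, and $\hat{G}^\alpha(b,n)=0$ for $b<2$. *)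

(* Defs.v *)
From mathcomp Require Import all_boot all_order all_algebra.
From mathcomp Require Import all_classical all_reals all_analysis.

Set Implicit Arguments.
Unset Strict Implicit.
Unset Printing Implicit Defensive.

Import Order.TTheory GRing.Theory Num.Theory.
Import numFieldNormedType.Exports.

Local Open Scope nat_scope.
Local Open Scope classical_set_scope.

Definition natfun (n : nat) := n.-tuple nat -> nat.

Definition natfun1 (f : nat -> nat) : natfun 1 := fun v => f (nth 0 v 0).

Definition natfun2 (f : nat -> nat -> nat) : natfun 2 :=
  fun v => f (nth 0 v 0) (nth 0 v 1).

(* The constant 0 is taken of arity 0; composition with [m = 0] below gives the
   zero functions of all arities. *)
Inductive initial : forall n, natfun n -> Prop :=
| initial_exp2 : initial (natfun1 (fun x => 2 ^ x))
| initial_max : initial (natfun2 maxn)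
| initial_zero : initial ((fun=> 0) : natfun 0)
| initial_succ : initial (natfun1 succn)
| initial_proj n (i : 'I_n) : initial ((fun v => tnth v i) : natfun n).

Definition is_comp m n (f : natfun n) (h : natfun m) (g : 'I_m -> natfun n) :=
  forall v, f v = h [tuple g i v | i < m].

(* The recursion variable is the first argument. *)
Definition is_primrec n (f : natfun n.+1) (g : natfun n) (h : natfun n.+2) :=
  (forall v : n.-tuple nat, f [tuple of 0 :: v] = g v) /\
  (forall y (v : n.-tuple nat), f [tuple of y.+1 :: v] =
               h [tuple of [:: y, f [tuple of y :: v] & v]]).

Inductive elementary : forall n, natfun n -> Prop :=
| elem_initial n (f : natfun n) : initial f -> elementary f
| elem_comp m n (f : natfun n) (h : natfun m) (g : 'I_m -> natfun n) :
    elementary h -> (forall i, elementary (g i)) -> is_comp f h g ->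
    elementary f
| elem_bprimrec n (f : natfun n.+1) (g : natfun n) (h : natfun n.+2)
    (j : natfun n.+1) :
    elementary g -> elementary h -> elementary j ->
    is_primrec f g h -> (forall v, f v <= j v) ->
    elementary f.

(* [primrec_in psi phi] : phi is primitive recursive in psi, phi <=_PR psi. *)
Inductive primrec_in p (psi : natfun p) : forall n, natfun n -> Prop :=
| prin_oracle : primrec_in psi psi
| prin_initial n (f : natfun n) : initial f -> primrec_in psi f
| prin_comp m n (f : natfun n) (h : natfun m) (g : 'I_m -> natfun n) :
    primrec_in psi h -> (forall i, primrec_in psi (g i)) -> is_comp f h g ->
    primrec_in psi f
| prin_primrec n (f : natfun n.+1) (g : natfun n) (h : natfun n.+2) :
    primrec_in psi g -> primrec_in psi h -> is_primrec f g h ->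
    primrec_in psi f.

Definition elementary_rel2 (r : rel nat) :=
  elementary (natfun2 (fun x y => nat_of_bool (r x y))).

Definition honest (f : nat -> nat) :=
  [/\ forall x, f x <= f x.+1,
      forall x, 2 ^ x <= f x &
      elementary_rel2 (fun x y => f x == y)].

(* Rationals are coded as the Cantor pair of (the code of) the numerator and
   the positive denominator in lowest terms. *)
Definition pair_code (a b : nat) : nat := ((a + b) * (a + b).+1)./2 + a.

Definition int_code (z : int) : nat :=
  match z with Posz n => n.*2 | Negz n => n.*2.+1 end.

Definition rat_code (q : rat) : nat :=
  pair_code (int_code (numq q)) (absz (denq q)).

Lemma ex_prime_above (m : nat) : exists p, (m < p) && prime p.
Proof. by have [p mp pp] := prime_above m; exists p; rewrite mp pp. Qed.

Fixpoint nth_prime (i : nat) : nat :=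
  match i with
  | 0 => 2
  | i'.+1 => ex_minn (ex_prime_above (nth_prime i'))
  end.

Fixpoint gseq (j : nat) : nat :=
  match j with
  | 0 => 1
  | j'.+1 => nth_prime j' ^ (2 * (j' + 2) * (gseq j' + 1) ^ 3)
  end.

Definition hseq (f : nat -> nat) (i : nat) : nat := gseq (f i + i).

Arguments nth_prime : simpl never.
Arguments gseq : simpl never.

Definition alpha_seq (R : realType) (f : nat -> nat) (n : nat) : R :=
  (\sum_(i < n.+1) (nth_prime i)%:R ^- hseq f i)%R.

Definition alpha (R : realType) (f : nat -> nat) : R :=
  limn (alpha_seq R f).

(* Indices are shifted by one: [Dk.1 i] and [Dk.2 i] are D_{i+1} and k_{i+1}. *)
Definition is_expansion (R : realType) (a : R) (b : nat)
    (Dk : (nat -> nat) * (nat -> nat)) : Prop :=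
  [/\ forall i, 0 < Dk.1 i < b,
      0 < Dk.2 0,
      forall i, Dk.2 i < Dk.2 i.+1 &
      (series (fun i => (Dk.1 i)%:R * b%:R ^- Dk.2 i) @ \oo --> a)%R].

(* For b >= 2 and a in (0,1), there is exactly one such expansion; the default
   value of [xget] is then irrelevant. *)
Definition expansion (R : realType) (a : R) (b : nat)
    : (nat -> nat) * (nat -> nat) :=
  xget (fun=> 0, fun=> 0) [set Dk | is_expansion a b Dk].

Definition ghat (R : realType) (a : R) (b n : nat) : rat :=
  match n with
  | 0 => 0%R
  | n'.+1 => if b < 2 then 0%R
             else (((expansion a b).1 n')%:R * b%:R ^- (expansion a b).2 n')%R
  end.

Definition ghat_coded (R : realType) (a : R) : natfun 2 :=
  natfun2 (fun b n => rat_code (ghat a b n)).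

(* Main.v *)
(* Let [b] be a common multiple of the primes [P_0, ..., P_n]. In base [b] the
   partial sum [alpha_n] is a multiple of [b ^ - h n], and [h (n+1)] is so large
   that [alpha - alpha_n <= 2 ^ (1 - h (n+1)) <= b ^ - h n], so the expansion of
   [alpha] begins with digits that sum to [alpha_n]. Hence every nonzero digit
   beyond the first [h n] ones contributes at most [2 ^ (1 - h (n+1))], and the
   denominator of the corresponding value of the sum approximation exceeds
   [f (n+1)]. As the graph
   of [f] is elementary, [f (n+1)] is found by a search below that bound, which
   is computed from [f n]: this is a primitive recursion. Neither the primes
   nor [h] need be computed, primitive recursive bounds on them suffice. *)

Require Import Defs.
From mathcomp Require Import all_boot all_order all_algebra.
From mathcomp Require Import all_classical all_reals all_analysis.
From mathcomp Require Import zify.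

Set Implicit Arguments.
Unset Strict Implicit.
Unset Printing Implicit Defensive.

Import Order.TTheory GRing.Theory Num.Theory.
Import numFieldNormedType.Exports.

Local Open Scope classical_set_scope.
Local Open Scope nat_scope.

(** * Closure properties of relative primitive recursion *)

Section PrimrecIn.
Variables (p : nat) (psi : natfun p).
Local Notation PR := (primrec_in psi).

Lemma primrec_in_elementary n (f : natfun n) : elementary f -> PR f.
Proof.
elim=> {n f} [n f|m n f h g _ PRh _ PRg fE|n f g h j _ PRg _ PRh _ _ fE _].
- exact: prin_initial.
- exact: prin_comp PRh PRg fE.
- exact: prin_primrec PRg PRh fE.
Qed.

Lemma primrec_in_nth n i : i < n -> PR ((fun v => nth 0 v i) : natfun n).
Proof.
move=> lt_in; rewrite (_ : (fun v => _) = fun v => tnth v (Ordinal lt_in)).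
  exact/prin_initial/initial_proj.
by apply/funext => v; rewrite (tnth_nth 0).
Qed.

Lemma primrec_in_comp1 n (f : nat -> nat) (g : natfun n) :
  PR (natfun1 f) -> PR g -> PR ((fun v => f (g v)) : natfun n).
Proof.
move=> PRf PRg; apply: (prin_comp (g := fun=> g) PRf) => // v.
by rewrite /natfun1 -(tnth_nth 0 _ (ord0 : 'I_1)) tnth_mktuple.
Qed.

Lemma primrec_in_comp2 n (f : nat -> nat -> nat) (g1 g2 : natfun n) :
  PR (natfun2 f) -> PR g1 -> PR g2 ->
  PR ((fun v => f (g1 v) (g2 v)) : natfun n).
Proof.
move=> PRf PRg1 PRg2.
apply: (prin_comp (g := fun i : 'I_2 => if i == 0 :> nat then g1 else g2) PRf).
  by move=> i; case: ifP.
move=> v; rewrite /natfun2.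
rewrite -(tnth_nth 0 _ (ord0 : 'I_2)) -(tnth_nth 0 _ (ord_max : 'I_2)).
by rewrite !tnth_mktuple.
Qed.

Lemma primrec_in_succ n (g : natfun n) :
  PR g -> PR ((fun v => (g v).+1) : natfun n).
Proof. exact/primrec_in_comp1/prin_initial/initial_succ. Qed.

Lemma primrec_in_const n c : PR ((fun=> c) : natfun n).
Proof.
elim: c => [|c]; last exact: primrec_in_succ.
apply: (prin_comp (m := 0) (h := fun=> 0) (g := fun=> fun=> 0)) => //.
- exact/prin_initial/initial_zero.
- by case.
Qed.

Lemma primrec_in_rec1 (F : nat -> nat) (h : nat -> nat -> nat) :
  PR (natfun2 h) -> (forall y, F y.+1 = h y (F y)) -> PR (natfun1 F).
Proof.
move=> PRh FS; apply: (prin_primrec (n := 0) (primrec_in_const 0 (F 0)) PRh).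
by split=> [//|y v]; rewrite /natfun1 /natfun2 /= FS.
Qed.

Lemma primrec_in_rec2 (F : nat -> nat -> nat) (g : nat -> nat)
    (h : nat -> nat -> nat -> nat) :
  PR (natfun1 g) ->
  PR ((fun v => h (nth 0 v 0) (nth 0 v 1) (nth 0 v 2)) : natfun 3) ->
  (forall x, F 0 x = g x) -> (forall y x, F y.+1 x = h y (F y x) x) ->
  PR (natfun2 F).
Proof.
move=> PRg PRh F0 FS; apply: (prin_primrec PRg PRh).
by split=> [|y] v; rewrite /natfun1 /natfun2 /= ?F0 ?FS.
Qed.

Lemma primrec_in_add n (g1 g2 : natfun n) :
  PR g1 -> PR g2 -> PR ((fun v => g1 v + g2 v) : natfun n).
Proof.
apply/primrec_in_comp2.
apply: (primrec_in_rec2 (g := id) (h := fun _ z _ => z.+1)) => //.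
- exact: primrec_in_nth.
- exact/primrec_in_succ/primrec_in_nth.
Qed.

Lemma primrec_in_mul n (g1 g2 : natfun n) :
  PR g1 -> PR g2 -> PR ((fun v => g1 v * g2 v) : natfun n).
Proof.
apply/primrec_in_comp2.
apply: (primrec_in_rec2 (g := fun=> 0) (h := fun _ z x => x + z)) => //.
- exact: primrec_in_const.
- by apply: primrec_in_add; exact: primrec_in_nth.
Qed.

Lemma primrec_in_exp n (g1 g2 : natfun n) :
  PR g1 -> PR g2 -> PR ((fun v => g1 v ^ g2 v) : natfun n).
Proof.
move=> PRg1 PRg2; apply: (primrec_in_comp2 (f := fun y x => x ^ y) _ PRg2 PRg1).
apply: (primrec_in_rec2 (g := fun=> 1) (h := fun _ z x => x * z)).
- exact: primrec_in_const.
- by apply: primrec_in_mul; exact: primrec_in_nth.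
- exact: expn0.
- by move=> y x; rewrite expnS.
Qed.

Lemma primrec_in_fact : PR (natfun1 factorial).
Proof.
apply: (primrec_in_rec1 (h := fun y z => y.+1 * z)); last exact: factS.
by apply: primrec_in_mul; [apply: primrec_in_succ|]; exact: primrec_in_nth.
Qed.

Section Graph.
Variable f : nat -> nat.
Hypothesis f_graph : PR (natfun2 (fun x y => f x == y : nat)).

Lemma primrec_in_graph_search :
  PR (natfun2 (fun y x => if f x <= y then f x else 0)).
Proof.
apply: (primrec_in_rec2 (g := fun=> 0)
  (h := fun y z x => z + y.+1 * (f x == y.+1))).
- exact: primrec_in_const.
- have PRsucc : PR ((fun v => (nth 0 v 0).+1) : natfun 3).
    exact/primrec_in_succ/primrec_in_nth.
  apply: primrec_in_add; first exact: primrec_in_nth.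
  apply: primrec_in_mul => //.
  by apply: (primrec_in_comp2 f_graph) => //; exact: primrec_in_nth.
- by move=> x; case: leqP; lia.
- move=> y x; case: eqP => /= [->|ne_fx]; first by rewrite ltnn leqnn muln1.
  by rewrite muln0 addn0 leq_eqVlt; move/eqP/negPf: ne_fx => ->.
Qed.

Lemma primrec_in_graph_bound (bound : nat -> nat -> nat) :
  PR (natfun2 bound) -> (forall n, f n.+1 <= bound n (f n)) -> PR (natfun1 f).
Proof.
move=> PRbound f_le_bound.
apply: (primrec_in_rec1
  (h := fun n y => if f n.+1 <= bound n y then f n.+1 else 0)).
  apply: (primrec_in_comp2 primrec_in_graph_search) => //.
  exact/primrec_in_succ/primrec_in_nth.
by move=> n; rewrite f_le_bound.
Qed.

End Graph.
End PrimrecIn.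

(* [(common_base n).+1] bounds the next prime by Euclid's argument. *)
Fixpoint common_base (n : nat) : nat :=
  if n is n'.+1 then (common_base n').+1`! else 2.

Fixpoint gseq_bound (j : nat) : nat :=
  if j is j'.+1
  then common_base j' ^ (2 * (j' + 2) * (gseq_bound j' + 1) ^ 3) else 1.

Lemma primrec_in_common_base p (psi : natfun p) :
  primrec_in psi (natfun1 common_base).
Proof.
apply: (primrec_in_rec1 (h := fun _ z => z.+1`!)) => //.
by apply/(primrec_in_comp1 (primrec_in_fact _))/primrec_in_succ/primrec_in_nth.
Qed.

Lemma primrec_in_gseq_bound p (psi : natfun p) :
  primrec_in psi (natfun1 gseq_bound).
Proof.
apply: (primrec_in_rec1
  (h := fun j z => common_base j ^ (2 * (j + 2) * (z + 1) ^ 3))) => //.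
apply: primrec_in_exp.
  by apply/(primrec_in_comp1 (primrec_in_common_base _))/primrec_in_nth.
by do ?[exact: primrec_in_nth | exact: primrec_in_const
       | apply: primrec_in_add | apply: primrec_in_mul | apply: primrec_in_exp].
Qed.

(** * Growth of the primes and of the sequence g *)

Lemma ltn_increasing (k : nat -> nat) :
  0 < k 0 -> (forall i, k i < k i.+1) -> forall i, i < k i.
Proof. by move=> k0 kS; elim=> // i IHi; exact: leq_ltn_trans IHi (kS i). Qed.

Lemma dvdn_fact_fact m n : m <= n -> m`! %| n`!.
Proof. by move=> /bin_fact <-; rewrite mulnCA dvdn_mulr. Qed.

Lemma fact_le_exp2 n : n`! <= 2 ^ (n ^ 2).
Proof.
elim: n => [//|n IHn]; rewrite factS.
have -> : n.+1 ^ 2 = n.+1 + (n + n ^ 2) by lia.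
rewrite expnD leq_mul ?(ltnW (ltn_expl _ _)) // (leq_trans IHn) //.
by rewrite leq_exp2l // leq_addl.
Qed.

Lemma prime_between_fact m : exists2 p, prime p & m < p <= m`!.+1.
Proof.
have m1_gt1 : 1 < m`!.+1 by rewrite ltnS fact_gt0.
exists (pdiv m`!.+1); first exact: pdiv_prime.
rewrite pdiv_leq // andbT ltnNge; apply/negP => le_pm.
have dvd_fact : pdiv m`!.+1 %| m`! by rewrite dvdn_fact // pdiv_gt0.
have := pdiv_dvd m`!.+1; rewrite -[X in _ %| X]addn1 dvdn_addr // dvdn1.
by move/eqP => p1; have := pdiv_prime m1_gt1; rewrite p1.
Qed.

Lemma nth_prime_prime i : prime (nth_prime i).
Proof.
by case: i => [//|i]; rewrite /nth_prime /=; case: ex_minnP => m /andP[].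
Qed.

Lemma nth_prime_gt1 i : 1 < nth_prime i.
Proof. exact/prime_gt1/nth_prime_prime. Qed.

Lemma nth_primeS_bounds i :
  nth_prime i < nth_prime i.+1 <= (nth_prime i)`!.+1.
Proof.
rewrite [nth_prime i.+1]/nth_prime /= -/(nth_prime i).
case: ex_minnP => m /andP[-> _] min_m /=.
have [q q_prime /andP[lt_q q_le]] := prime_between_fact (nth_prime i).
by apply: leq_trans q_le; rewrite min_m // lt_q.
Qed.

Lemma nth_prime_le : {homo nth_prime : i j / i <= j}.
Proof.
apply: homo_leq => [//||i]; first exact: leq_trans.
by have /andP[/ltnW] := nth_primeS_bounds i.
Qed.

Lemma common_base_gt1 n : 1 < common_base n.
Proof.
by elim: n => [//|n IHn] /=; apply: leq_trans (fact_geq _); exact: ltnW.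
Qed.

Lemma nth_prime_fact_dvd_common_base n : (nth_prime n)`! %| common_base n.
Proof.
elim: n => [//|n /(dvdn_leq (ltnW (common_base_gt1 n))) le_base].
apply: dvdn_fact_fact; have /andP[_ le_fact] := nth_primeS_bounds n.
exact: leq_trans le_fact _.
Qed.

Lemma nth_prime_dvd_common_base i n : i <= n -> nth_prime i %| common_base n.
Proof.
move=> le_in; apply: dvdn_trans (nth_prime_fact_dvd_common_base n).
by rewrite dvdn_fact // (ltnW (nth_prime_gt1 i)) nth_prime_le.
Qed.

Lemma nth_prime_le_common_base n : nth_prime n <= common_base n.
Proof.
exact: dvdn_leq (ltnW (common_base_gt1 n)) (nth_prime_dvd_common_base _).
Qed.

Lemma gseqS j :
  gseq j.+1 = nth_prime j ^ (2 * (j + 2) * (gseq j + 1) ^ 3).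
Proof. by []. Qed.

Lemma gseq_exponent_gt0 j x : 0 < 2 * (j + 2) * (x + 1) ^ 3.
Proof. by rewrite muln_gt0 expn_gt0 addn1 addn2. Qed.

Lemma exp2_cube_le_gseqS j : 2 ^ (4 * (gseq j + 1) ^ 3) <= gseq j.+1.
Proof.
rewrite gseqS; apply: (@leq_trans (2 ^ (2 * (j + 2) * (gseq j + 1) ^ 3))).
  by rewrite leq_exp2l // leq_mul2r; apply/orP; right; lia.
by rewrite leq_exp2r ?nth_prime_gt1 // gseq_exponent_gt0.
Qed.

Lemma cube_lt_gseqS j : (gseq j + 1) ^ 3 < gseq j.+1.
Proof.
apply: leq_trans (exp2_cube_le_gseqS j).
apply: leq_trans (ltn_expl _ (ltnSn 1)) _.
by rewrite leq_exp2l //; lia.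
Qed.

Lemma gseq_lt j : gseq j < gseq j.+1.
Proof.
by apply: leq_ltn_trans (cube_lt_gseqS j); rewrite !expnS expn0; nia.
Qed.

Lemma gseq_le : {homo gseq : i j / i <= j}.
Proof.
by apply: homo_leq => [//||j]; [exact: leq_trans|exact/ltnW/gseq_lt].
Qed.

Lemma gseq_gt j : j < gseq j.
Proof. exact: (ltn_increasing _ gseq_lt). Qed.

Lemma gseq_le_bound j : gseq j <= gseq_bound j.
Proof.
elim: j => [//|j IHj]; rewrite gseqS /=.
apply: (@leq_trans (common_base j ^ (2 * (j + 2) * (gseq j + 1) ^ 3))).
  by rewrite leq_exp2r ?nth_prime_le_common_base // gseq_exponent_gt0.
rewrite leq_exp2l ?common_base_gt1 // leq_mul2l leq_exp2r // leq_add2r IHj.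
by rewrite orbT.
Qed.

Lemma common_base_le_exp2 n : common_base n <= 2 ^ ((gseq n + 1) ^ 2).
Proof.
elim: n => [//|n IHn] /=; apply: leq_trans (fact_le_exp2 _) _.
rewrite leq_exp2l // leq_exp2r // addn1 ltnS.
apply: leq_trans IHn (leq_trans _ (exp2_cube_le_gseqS n)).
rewrite leq_exp2l // (expnS _ 2); nia.
Qed.

Lemma common_base_exp_gseq_le n j :
  n <= j -> common_base n ^ gseq j <= 2 ^ (gseq j.+1).-1.
Proof.
move=> /gseq_le le_g.
apply: (@leq_trans (2 ^ ((gseq j + 1) ^ 2 * gseq j))).
  rewrite expnM leq_exp2r; last by rewrite (leq_ltn_trans _ (gseq_gt j)).
  apply: leq_trans (common_base_le_exp2 n) _.
  by rewrite leq_exp2l // leq_exp2r // leq_add2r.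
by have := cube_lt_gseqS j; rewrite leq_exp2l // !expnS expn0; nia.
Qed.

Section NondecreasingHseq.
Variable f : nat -> nat.
Hypothesis f_le : forall x, f x <= f x.+1.

Lemma gseqS_le_hseqS n : gseq (f n + n).+1 <= hseq f n.+1.
Proof. by apply: gseq_le; have := f_le n; lia. Qed.

Lemma hseq_lt n : hseq f n < hseq f n.+1.
Proof. exact: leq_trans (gseq_lt _) (gseqS_le_hseqS n). Qed.

Lemma hseq_le : {homo hseq f : i j / i <= j}.
Proof.
by apply: homo_leq => [//||j]; [exact: leq_trans|exact/ltnW/hseq_lt].
Qed.

Lemma common_base_exp_hseq_le n :
  common_base n ^ hseq f n <= 2 ^ (hseq f n.+1).-1.
Proof.
apply: leq_trans (common_base_exp_gseq_le (leq_addl (f n) n)) _.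
by rewrite leq_exp2l //; have := gseqS_le_hseqS n; lia.
Qed.

End NondecreasingHseq.

(** * Sums of powers of the inverse of the base *)

Section NatrExpV.
Variables (R : archiRealFieldType) (b : nat).
Hypothesis b_gt1 : 1 < b.
Local Open Scope ring_scope.

Lemma natr_exp_gt0 k : 0 < b%:R ^+ k :> R.
Proof. by rewrite exprn_gt0 // ltr0n ltnW. Qed.

Lemma natr_expV_gt0 k : 0 < b%:R ^- k :> R.
Proof. by rewrite invr_gt0 natr_exp_gt0. Qed.

Lemma natr_expV_lt i j : (b%:R ^- i < b%:R ^- j :> R) = (j < i)%N.
Proof. by rewrite ltf_pV2 ?posrE ?natr_exp_gt0 // ltr_eXn2l // ltr1n. Qed.

Lemma natr_expV_le i j : (b%:R ^- i <= b%:R ^- j :> R) = (j <= i)%N.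
Proof. by rewrite leNgt natr_expV_lt -leqNgt. Qed.

Lemma cvg_natr_expV : b%:R ^- n @[n --> \oo] --> (0 : R).
Proof.
under eq_cvg do rewrite -exprVn.
apply: cvg_expr; rewrite ger0_norm ?invr_ge0 //.
by rewrite invf_lt1 ?ltr1n ?ltr0n // ltnW.
Qed.

Lemma natr_expV_pred k :
  (0 < k)%N -> b.-1%:R * b%:R ^- k + b%:R ^- k = b%:R ^- k.-1 :> R.
Proof.
case: k => // k _; rewrite -[X in _ + X]mul1r -mulrDl natr1.
rewrite prednK ?(ltnW b_gt1) // exprS invfM mulrA divff ?mul1r //.
by rewrite pnatr_eq0 -lt0n ltnW.
Qed.

End NatrExpV.

Section DigitSeries.
Variables (R : realType) (b : nat) (t : R^nat) (k : nat -> nat).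
Hypothesis b_gt1 : 1 < b.
Local Open Scope ring_scope.
Hypothesis t_gt0 : forall i, 0 < t i.
Hypothesis t_le : forall i, t i <= b.-1%:R * b%:R ^- k i.
Hypothesis k0_gt0 : (0 < k 0)%N.
Hypothesis k_lt : forall i, (k i < k i.+1)%N.

Let series_le : {homo series t : m n / (m <= n)%N >-> m <= n}.
Proof. by apply: nondecreasing_series => n _ _; exact: ltW. Qed.

Let upper n := series t n + b%:R ^- (k n).-1.

Let upper_le : {homo upper : m n / (m <= n)%N >-> n <= m}.
Proof.
apply/nonincreasing_seqP => n; rewrite /upper seriesSr -addrA lerD2l.
have k_gt0 := leq_ltn_trans (leq0n n) (ltn_increasing k0_gt0 k_lt n).
rewrite -(natr_expV_pred R b_gt1 k_gt0).
by rewrite lerD ?t_le // natr_expV_le; have := k_lt n; lia.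
Qed.

Let series_le_upper m n : series t m <= upper n.
Proof.
apply: le_trans (series_le (leq_maxl m n)) _.
apply: le_trans (upper_le (leq_maxr m n)).
by rewrite lerDl ltW ?natr_expV_gt0.
Qed.

Lemma is_cvg_digit_series : cvgn (series t).
Proof.
apply: nondecreasing_is_cvgn => //.
by exists (upper 0) => _ [n _ <-]; exact: series_le_upper.
Qed.

Lemma digit_series_lt n : series t n < limn (series t).
Proof.
apply: lt_le_trans (nondecreasing_cvgn_le series_le is_cvg_digit_series n.+1).
by rewrite seriesSr ltrDl.
Qed.

Lemma digit_series_tail_le n :
  limn (series t) <= series t n + b%:R ^- (k n).-1.
Proof.
apply: limr_le; first exact: is_cvg_digit_series.
by apply: nearW => m; exact: series_le_upper.
Qed.

End DigitSeries.

(** * Expansions in a base *)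

Section LeadingTerm.
Variables (R : archiRealFieldType) (b : nat).
Hypothesis b_gt1 : 1 < b.
Local Open Scope ring_scope.

(* The first bound on [r] is strict so that a positive remainder is left and the
   greedy expansion never terminates. *)
Definition is_leading_term (r : R) (k d : nat) :=
  [/\ (0 < k)%N, (0 < d < b)%N, d%:R * b%:R ^- k < r
    & r <= d.+1%:R * b%:R ^- k].

Lemma leading_exponent (r : R) :
  0 < r <= 1 -> exists k, b%:R ^- k.+1 < r <= b%:R ^- k.
Proof.
move=> /andP[r_gt0 r_le1].
have exk : exists k, b%:R ^- k < r.
  exists (Num.bound r^-1); rewrite invf_plt ?posrE ?natr_exp_gt0 //.
  apply: lt_trans (archi_boundP _) _; first by rewrite invr_ge0 ltW.
  by rewrite -natrX ltr_nat ltn_expl.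
case: (ex_minnP exk) => [[|k] lt_r mink].
  by move: lt_r; rewrite expr0 invr1 ltNge r_le1.
by exists k; rewrite lt_r leNgt; apply/negP => /mink; rewrite ltnn.
Qed.

Lemma nat_ceil (x : R) : 0 < x -> exists d : nat, d%:R < x <= d.+1%:R.
Proof.
rewrite -ceil_gt0; have := ceil_itv x; case: (Num.ceil x) => [[|d]|] //= x_d _.
by exists d; move: x_d; rewrite -addn1 PoszD addrK.
Qed.

Lemma leading_term_exists (r : R) :
  0 < r <= 1 -> exists k d, is_leading_term r k d.
Proof.
move=> /leading_exponent[k /andP[lt_r r_le]].
have bX_gt0 m : 0 < b%:R ^+ m :> R by exact: natr_exp_gt0.
pose x := r * b%:R ^+ k.+1.
have x_gt1 : 1 < x by rewrite -ltr_pdivrMr // div1r.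
have x_le : x <= b%:R.
  by rewrite /x exprS mulrCA ler_piMr // -ler_pdivlMr // div1r.
have [d /andP[d_lt le_d]] := nat_ceil (lt_trans ltr01 x_gt1).
exists k.+1, d; split=> //.
- apply/andP; split; last by rewrite -(ltr_nat R) (lt_le_trans d_lt).
  by have := lt_le_trans x_gt1 le_d; rewrite ltr1n.
- by rewrite ltr_pdivrMr.
- by rewrite ler_pdivlMr.
Qed.

End LeadingTerm.

Section Greedy.
Variables (R : realType) (b : nat) (a : R) (k d : R -> nat).
Hypothesis b_gt1 : 1 < b.
Local Open Scope ring_scope.
Hypothesis a01 : 0 < a <= 1.
Hypothesis kdP : forall r, 0 < r <= 1 -> is_leading_term b r (k r) (d r).

Definition greedy_remainder n := iter n (fun r => r - (d r)%:R * b%:R ^- k r) a.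
Local Notation rem := greedy_remainder.

Lemma greedy_remainder01 n : 0 < rem n <= 1.
Proof.
elim: n => [//|n rem01] /=; have [_ _ lt_rem _] := kdP rem01.
rewrite subr_gt0 lt_rem /=; case/andP: rem01 => _; apply: le_trans.
by rewrite gerBl mulr_ge0 // ltW // natr_expV_gt0.
Qed.

Lemma greedy_remainderS_le n : rem n.+1 <= b%:R ^- k (rem n).
Proof.
have [_ _ _] := kdP (greedy_remainder01 n).
by rewrite -natr1 mulrDl mul1r lerBlDl.
Qed.

Lemma greedy_exponent_lt n : (k (rem n) < k (rem n.+1))%N.
Proof.
rewrite -(natr_expV_lt R b_gt1); apply: lt_le_trans (greedy_remainderS_le n).
have [_ /andP[d_gt0 _] + _] := kdP (greedy_remainder01 n.+1).
by apply: le_lt_trans; rewrite ler_peMl ?ler1n // ltW // natr_expV_gt0.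
Qed.

Lemma greedy_exponent0_gt0 : (0 < k (rem 0))%N.
Proof. by have [] := kdP (greedy_remainder01 0). Qed.

Lemma greedy_remainder_cvg0 : rem @ \oo --> (0 : R).
Proof.
rewrite -(cvg_shiftS rem).
apply: (squeeze_cvgr _ (cvg_cst 0) (@cvg_natr_expV R b b_gt1)).
apply: nearW => n; have /andP[/ltW -> _] := greedy_remainder01 n.+1.
apply: le_trans (greedy_remainderS_le n) _; rewrite natr_expV_le //.
exact/ltnW/(ltn_increasing greedy_exponent0_gt0 greedy_exponent_lt).
Qed.

Lemma greedy_series n :
  series (fun i => (d (rem i))%:R * b%:R ^- k (rem i)) n = a - rem n.
Proof.
elim: n => [|n IHn]; first by rewrite /series /= big_geq // subrr.
by rewrite seriesSr IHn /= opprB [RHS]addrA addrAC.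
Qed.

Lemma greedy_is_expansion :
  is_expansion a b (fun n => d (rem n), fun n => k (rem n)).
Proof.
split=> /=.
- by move=> i; have [] := kdP (greedy_remainder01 i).
- exact: greedy_exponent0_gt0.
- exact: greedy_exponent_lt.
- rewrite (funext greedy_series) -[X in _ --> X]subr0.
  by apply: cvgB greedy_remainder_cvg0; exact: cvg_cst.
Qed.

End Greedy.

Lemma expansionP (R : realType) (a : R) (b : nat) :
  1 < b -> (0 < a <= 1)%R -> is_expansion a b (expansion a b).
Proof.
move=> b_gt1 a01; have /choice[kd kdP] : forall r : R, exists kd : nat * nat,
    (0 < r <= 1)%R -> is_leading_term b r kd.1 kd.2.
  move=> r; have [|nr] := pselect (0 < r <= 1)%R.
    by move=> /(leading_term_exists b_gt1)[k [d ?]]; exists (k, d).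
  by exists (0%N, 0%N).
by apply: xgetPex; eexists; exact: (greedy_is_expansion b_gt1 a01 kdP).
Qed.

Section NatMultiples.
Variable R : archiRealFieldType.
Local Open Scope ring_scope.

Lemma natr_div_nat d m : (d %| m)%N -> m%:R / d%:R \is a @Num.nat R.
Proof.
have [->|d_gt0 /dvdnP[q ->]] := posnP d; first by rewrite invr0 mulr0.
by rewrite natrM mulfK ?pnatr_eq0 -?lt0n.
Qed.

Lemma nat_multiple_floor_uniq (q c c' x : R) : 0 < q ->
    c * q \is a Num.nat -> c' * q \is a Num.nat ->
  c < x <= c + q^-1 -> c' < x <= c' + q^-1 -> c = c'.
Proof.
move=> q_gt0.
have le_mul u v : u * q \is a Num.nat -> v * q \is a Num.nat ->
    u < v + q^-1 -> u <= v.
  move=> /natrP[i uE] /natrP[j vE].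
  rewrite -(ltr_pM2r q_gt0) -(ler_pM2r q_gt0) mulrDl mulVf ?gt_eqF // uE vE.
  by rewrite natr1 ltr_nat ltnS ler_nat.
move=> cq c'q /andP[c_lt le_c] /andP[c'_lt le_c']; apply: le_anti.
by rewrite !le_mul // ?(lt_le_trans c_lt) // (lt_le_trans c'_lt).
Qed.

End NatMultiples.

Section Truncation.
Variables (R : realType) (b : nat) (a : R) (Dk : (nat -> nat) * (nat -> nat)).
Hypothesis b_gt1 : 1 < b.
Hypothesis exp_a : is_expansion a b Dk.
Local Open Scope ring_scope.
Local Notation D := Dk.1.
Local Notation k := Dk.2.
Local Notation term := (fun i => (D i)%:R * b%:R ^- k i : R).

Let term_gt0 i : 0 < term i.
Proof.
have [/(_ i)/andP[D_gt0 _] _ _ _] := exp_a.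
by rewrite mulr_gt0 ?natr_expV_gt0 ?ltr0n.
Qed.

Let term_le i : term i <= b.-1%:R * b%:R ^- k i.
Proof.
have [/(_ i)/andP[_ D_lt] _ _ _] := exp_a.
by rewrite ler_pM2r ?natr_expV_gt0 // ler_nat; lia.
Qed.

Let lim_series : limn (series term) = a.
Proof. by have [_ _ _] := exp_a; exact: cvg_lim. Qed.

Lemma expansion_series_lt n : series term n < a.
Proof.
have [_ k0_gt0 k_lt _] := exp_a.
by rewrite -lim_series; exact: (digit_series_lt b_gt1).
Qed.

Lemma expansion_tail_le n : a <= series term n + b%:R ^- (k n).-1.
Proof.
have [_ k0_gt0 k_lt _] := exp_a.
by rewrite -lim_series; exact: digit_series_tail_le.
Qed.

Lemma expansion_series_mul_nat m H : (forall i, (i < m)%N -> (k i <= H)%N) ->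
  series term m * b%:R ^+ H \is a Num.nat.
Proof.
move=> k_le; rewrite /series /= big_mkord mulr_suml; apply: rpred_sum => i _.
rewrite -mulrA rpredM ?natr_nat // mulrC -!natrX natr_div_nat //.
exact/dvdn_exp2l/k_le.
Qed.

Lemma expansion_truncation (c : R) H : c * b%:R ^+ H \is a Num.nat ->
  c < a <= c + b%:R ^- H -> exists2 m, (m <= H)%N & series term m = c.
Proof.
move=> c_nat c_lt; have [_ k0_gt0 k_lt _] := exp_a.
have exm : exists m, (H < k m)%N by exists H; exact: ltn_increasing.
case: (ex_minnP exm) => m lt_Hk min_m.
exists m; first exact/min_m/ltn_increasing.
apply: (nat_multiple_floor_uniq (natr_exp_gt0 R b_gt1 H) _ c_nat _ c_lt).
  apply: expansion_series_mul_nat => i lt_im.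
  by rewrite leqNgt; apply: contraTN lt_im => /min_m; rewrite -leqNgt.
rewrite expansion_series_lt (le_trans (expansion_tail_le m)) //.
by rewrite lerD2l natr_expV_le //; lia.
Qed.

Lemma expansion_term_le (c : R) H N : c * b%:R ^+ H \is a Num.nat ->
  c < a <= c + b%:R ^- H -> (H <= N)%N -> term N <= a - c.
Proof.
move=> c_nat /(expansion_truncation c_nat)[m le_mH <-] le_HN.
rewrite lerBrDl; apply: le_trans (ltW (expansion_series_lt N.+1)).
rewrite seriesSr lerD2r; apply: nondecreasing_series (leq_trans le_mH le_HN).
by move=> i _ _; exact/ltW/term_gt0.
Qed.

End Truncation.

Lemma ratr_ghat (R : realType) (a : R) b n : 1 < b ->
  (ratr (ghat a b n.+1) =
   ((expansion a b).1 n)%:R * b%:R ^- (expansion a b).2 n :> R)%R.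
Proof.
move=> b_gt1; rewrite /ghat ltnNge b_gt1 /=.
by rewrite rmorphM fmorphV rmorphXn !rmorph_nat.
Qed.

(** * The expansion of alpha *)

Section Alpha.
Variables (R : realType) (f : nat -> nat).
Hypothesis f_le : forall x, f x <= f x.+1.
Local Open Scope ring_scope.
Local Notation h := (hseq f).
Local Notation term := (fun i => (nth_prime i)%:R ^- h i : R).

Let term_gt0 i : 0 < term i.
Proof. exact/natr_expV_gt0/nth_prime_gt1. Qed.

Let term_le i : term i <= 2.-1%:R * 2%:R ^- h i.
Proof.
have P_gt1 := nth_prime_gt1 i.
by rewrite mul1r lef_pV2 ?posrE ?natr_exp_gt0 // lerXn2r ?nnegrE // ler_nat.
Qed.

Let h0_gt0 : (0 < h 0)%N. Proof. exact: leq_ltn_trans (gseq_gt _). Qed.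

Lemma alpha_seqE n : alpha_seq R f n = series term n.+1.
Proof. by rewrite /series /= big_mkord. Qed.

Lemma alphaE : alpha R f = limn (series term).
Proof.
apply: cvg_lim => //; rewrite (funext alpha_seqE) (cvg_shiftS (series term)).
exact: is_cvg_digit_series term_gt0 term_le h0_gt0 (hseq_lt f_le).
Qed.

Lemma alpha_gt n : alpha_seq R f n < alpha R f.
Proof.
rewrite alphaE alpha_seqE.
exact: digit_series_lt term_gt0 term_le h0_gt0 (hseq_lt f_le) _.
Qed.

Lemma alpha_le n : alpha R f <= alpha_seq R f n + 2%:R ^- (h n.+1).-1.
Proof.
rewrite alphaE alpha_seqE.
exact: digit_series_tail_le term_gt0 term_le h0_gt0 (hseq_lt f_le) _.
Qed.

Lemma alpha01 : 0 < alpha R f <= 1.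
Proof.
have series0 : series term 0 = 0 by rewrite /series /= big_geq.
rewrite alphaE; apply/andP; split.
  rewrite -{1}series0.
  exact: digit_series_lt term_gt0 term_le h0_gt0 (hseq_lt f_le) 0.
apply: le_trans (digit_series_tail_le _ term_gt0 term_le h0_gt0 _ 0) _ => //.
  exact: hseq_lt.
by rewrite series0 add0r invf_le1 ?exprn_gt0 // exprn_ege1 // ler1n.
Qed.

Lemma alpha_seq_mul_nat n :
  alpha_seq R f n * (common_base n)%:R ^+ h n \is a Num.nat.
Proof.
rewrite /alpha_seq mulr_suml; apply: rpred_sum => i _.
rewrite mulrC -!natrX natr_div_nat //.
have le_in : (i <= n)%N by rewrite -ltnS.
apply: dvdn_trans (dvdn_exp2l _ (hseq_le f_le le_in)).
exact/dvdn_exp2r/nth_prime_dvd_common_base.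
Qed.

Lemma ghat_alpha_bounds n N : (h n <= N)%N ->
  0 < ghat (alpha R f) (common_base n) N.+1 <= (2 ^ (h n.+1).-1)%:R^-1.
Proof.
move=> le_hN; have b_gt1 := common_base_gt1 n.
have exp_a := expansionP b_gt1 alpha01.
rewrite -(ltr0q R) -(ler_rat R) fmorphV rmorph_nat natrX ratr_ghat //.
apply/andP; split.
  have [/(_ N)/andP[D_gt0 _] _ _ _] := exp_a.
  by rewrite mulr_gt0 ?ltr0n ?natr_expV_gt0.
apply: (@le_trans _ _ (alpha R f - alpha_seq R f n)); last first.
  by rewrite lerBlDl alpha_le.
apply: (expansion_term_le b_gt1 exp_a (alpha_seq_mul_nat n) _ le_hN).
rewrite alpha_gt /=; apply: le_trans (alpha_le n) _.
rewrite lerD2l lef_pV2 ?posrE ?natr_exp_gt0 // -!natrX ler_nat.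
exact: common_base_exp_hseq_le.
Qed.

End Alpha.

Lemma leq_denq (q : rat) (m : nat) : (0 < q <= m%:R^-1)%R -> m <= `|denq q|.
Proof.
move=> /andP[q_gt0 q_le]; case: m q_le => [//|m] q_le.
have num_ge1 : (1 <= numq q)%R by rewrite -gtz0_ge1 numq_gt0.
have den_gt0 : (0 < (denq q)%:~R :> rat)%R by rewrite ltr0z denq_gt0.
rewrite -lez_nat absz_denq -(ler_int rat) -lef_pV2 ?posrE //.
apply: le_trans q_le; rewrite -[leRHS]divq_num_den -[leLHS]div1r.
by rewrite ler_pM2r ?invr_gt0 // -[X in (X <= _)%R]/(1%:~R)%R ler_int.
Qed.

Lemma denq_le_rat_code (q : rat) : `|denq q| <= rat_code q.
Proof. by rewrite /rat_code /pair_code; nia. Qed.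

Lemma leq_ghat_alpha_code (R : realType) (f : nat -> nat) n N :
  (forall x, f x <= f x.+1) -> hseq f n <= N ->
  f n.+1 <= rat_code (ghat (alpha R f) (common_base n) N.+1).
Proof.
move=> f_le le_hN; apply: leq_trans (denq_le_rat_code _).
apply: leq_trans (leq_denq (ghat_alpha_bounds R f_le le_hN)).
apply: leq_trans (ltnW (ltn_expl _ (ltnSn 1))).
by have := gseq_gt (f n.+1 + n.+1); rewrite -/(hseq f n.+1); lia.
Qed.

Theorem theorem2 (R : realType) (f : nat -> nat) (hf : honest f) :
  primrec_in (ghat_coded (alpha R f)) (natfun1 f).
Proof.
have [f_le _ /(primrec_in_elementary (ghat_coded (alpha R f))) f_graph] := hf.
apply: (primrec_in_graph_bound f_graph (bound := fun n y =>
  rat_code (ghat (alpha R f) (common_base n) (gseq_bound (y + n)).+1))).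
- apply: (primrec_in_comp2 (prin_oracle (ghat_coded (alpha R f)))).
    by apply/(primrec_in_comp1 (primrec_in_common_base _))/primrec_in_nth.
  apply/primrec_in_succ/(primrec_in_comp1 (primrec_in_gseq_bound _)).
  by apply: primrec_in_add; exact: primrec_in_nth.
- by move=> n; apply: leq_ghat_alpha_code => //; exact: gseq_le_bound.
Qed.
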